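(* Let $G=(V,E)$ be a locally finite simple graph, $R\ge1$ an integer, and $x,y\in V$ with $d(x,y)\le R$. (i) If there is no $y\to x$ $R$-transport map, then $K_R(x,y)=K_R^q(x,y)=K_R^e(x,y)=-\infty$. (ii) If there is a $y\to x$ $R$-transport map, then $K_R(x,y)\ge-\mathrm{def}(y\to x)$, $K_R^e(x,y)\ge-\mathrm{def}(y\to x)$, and $K_R^q(x,y)\ge-\frac32\,\mathrm{def}(y\to x)$. (iii) The following are equivalent: (a) Both $y\to x$ and $x\to y$ $R$-transport maps exist. (b) $\mathrm{def}(y\to x)=0$. (c) $K_R(x,y)\ge0$ and $K_R(y,x)\ge0$. (d) $K^q_R(x,y)\ge0$ and $K^q_R(y,x)\ge0$. (e) $K^e_R(x,y)\ge0$ and $K^e_R(y,x)\ge0$.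
   Context: $d(x,y)$ is the combinatorial (path) distance, $B_r(x)=\{y:d(x,y)\le r\}$, $\Delta f(x)=\sum_{y\sim x}(f(y)-f(x))$, $|\nabla_R f|(x)=\max_{d(x,y)\le R}|f(y)-f(x)|$, $\|\nabla_Rf\|_\infty=\sup_{x}|\nabla_Rf|(x)$. Transport maps: let $A$ be a set with $B_1(y)\setminus B_R(x)\subset A\subset B_1(y)$. A function $\phi:A\to B_1(x)$ is a $y\to x$ $R$-transport map if it is injective and $d(z,\phi(z))\le R$ for all $z\in A$. Its defect is $\mathrm{def}(\phi)=|B_1(x)\setminus(\phi(A)\cup B_R(y))|$. Let $\mathrm{def}(y\to x)$ be the infimum of $\mathrm{def}(\phi)$ over all $y\to x$ $R$-transport maps $\phi$ (over all admissible $A$), and $\infty$ if there are none. Curvatures (with $\inf\emptyset=+\infty$): $$K_R(x,y)=\inf\big\{\Delta|\nabla_R f|(x)-(\Delta f(y)-\Delta f(x))\,\mathrm{sgn}(f(y)-f(x))\big\}$$ over $f:V\to\mathbb{R}$ with $|\nabla_Rf|(x)=1$ and $|f(y)-f(x)|=|\nabla_Rf|(x)$; $$K_R^q(x,y)=\frac12\inf\Big\{\Delta|\nabla_R g|^2(x)-\mathrm{sgn}(g(y)-g(x))\Big(\frac{\Delta g^2}{g}(y)-\frac{\Delta g^2}{g}(x)\Big)\Big\}$$ over $g:V\to(0,\infty)$ with $|\nabla_Rg|(x)=1$ and $|g(y)-g(x)|=1$; $$K_R^e(x,y)=\inf_{r>0}\frac1r\inf\Big\{\frac{\Delta\exp(g)}{\exp(g)}(x)-\frac{\Delta\exp(g)}{\exp(g)}(y)\Big\}$$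 with inner infimum over $g:V\to\mathbb{R}$ with $\|\nabla_Rg\|_\infty=r$ and $g(y)-g(x)=r$. *)

(* Defs.v *)
From HB Require Import structures.
From mathcomp Require Import all_boot all_order all_algebra finmap.
From mathcomp Require Import all_classical all_reals all_analysis.
Set Implicit Arguments.
Unset Strict Implicit.
Unset Printing Implicit Defensive.
Import Order.TTheory GRing.Theory Num.Theory.
Local Open Scope classical_set_scope.
Local Open Scope ring_scope.

Record lfgraph (V : choiceType) := LFGraph {
  adj :> rel V;
  adj_sym : symmetric adj;
  adj_irr : irreflexive adj;
  adj_locally_finite : forall x, finite_set [set y | adj x y]
}.

Section Distance.
Variables (V : choiceType) (G : lfgraph V).

Definition walk_of_length (x y : V) (n : nat) : bool :=
  `[< exists p : seq V, [/\ path G x p, last x p = y & size p = n] >].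

(* [None] stands for infinite distance: the graph need not be connected. *)
Definition dist (x y : V) : option nat :=
  if pselect (exists n, walk_of_length x y n) is left h
  then Some (ex_minn h) else None.

Definition dist_le (x y : V) (n : nat) : bool :=
  if dist x y is Some m then (m <= n)%N else false.

Definition gball (n : nat) (x : V) : set V := [set y | dist_le x y n].

End Distance.

Section Gradient.
Variables (R : realType) (V : choiceType) (G : lfgraph V).

Definition lap (f : V -> R) (x : V) : R :=
  \sum_(y \in [set y | G x y]) (f y - f x).

(* Balls are finite and nonempty, so this supremum is a maximum. *)
Definition grad (rad : nat) (f : V -> R) (x : V) : R :=
  sup [set `|f y - f x| | y in gball G rad x].

Definition grad_norm (rad : nat) (f : V -> R) : \bar R :=
  ereal_sup [set (grad rad f x)%:E | x in setT].

End Gradient.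

Section Transport.
Variables (V : choiceType) (G : lfgraph V).

(* A map from A to B_1(x) is represented by a total function on V, of which
   only the values on A are ever used. *)
Definition transport_map (rad : nat) (y x : V) (A : set V) (phi : V -> V) :
    Prop :=
  [/\ gball G 1 y `\` gball G rad x `<=` A,
      A `<=` gball G 1 y,
      phi @` A `<=` gball G 1 x,
      set_inj A phi &
      forall z, A z -> dist_le G z (phi z) rad].

Definition has_transport_map (rad : nat) (y x : V) : Prop :=
  exists A phi, transport_map rad y x A phi.

Definition map_defect (rad : nat) (y x : V) (A : set V) (phi : V -> V) : nat :=
  #|` fset_set (gball G 1 x `\` (phi @` A `|` gball G rad y))|%N.

Definition defect (R : realType) (rad : nat) (y x : V) : \bar R :=
  ereal_inf [set d : \bar R | exists A phi,
    transport_map rad y x A phi /\ d = ((map_defect rad y x A phi)%:R)%:E].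

End Transport.

Section Curvatures.
Variables (R : realType) (V : choiceType) (G : lfgraph V) (rad : nat).
Implicit Types x y : V.

Definition curv x y : \bar R :=
  ereal_inf [set (lap G (grad G rad f) x
                  - (lap G f y - lap G f x) * Num.sg (f y - f x))%:E
    | f in [set f : V -> R |
        grad G rad f x = 1 /\ `|f y - f x| = grad G rad f x]].

Definition curv_q x y : \bar R :=
  ((2^-1 : R)%:E *
  (ereal_inf [set (lap G (fun z => grad G rad g z ^+ 2) x
                  - Num.sg (g y - g x) *
                    (lap G (fun z => g z ^+ 2) y / g y
                     - lap G (fun z => g z ^+ 2) x / g x))%:E
    | g in [set g : V -> R | [/\ forall z, 0 < g z,
        grad G rad g x = 1 & `|g y - g x| = 1]]])%R)%E.

Definition curv_e x y : \bar R :=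
  ereal_inf [set ((r^-1)%:E *
    (ereal_inf [set (lap G (fun z => expR (g z)) x / expR (g x)
                    - lap G (fun z => expR (g z)) y / expR (g y))%:E
      | g in [set g : V -> R |
          grad_norm G rad g = r%:E /\ g y - g x = r]])%R)%E
    | r in [set r : R | 0 < r]].

End Curvatures.

(* Main.v *)
(* Each of the three curvature expressions is a difference
   [sum_{z in B_1(x)} T z - sum_{w in B_1(y)} U w] in which [U w <= T z] whenever
   [d(w, z) <= R], [U <= 0] on [B_R(x)] and [0 <= T] on [B_R(y)].  A transport
   map therefore matches all terms up to its defect, and on the defect [T] is
   bounded below.  If no transport map exists, Hall's theorem gives a set
   [S] in [B_1(y) \ B_R(x)] with fewer than [|S|] points of [B_1(x)] within
   distance [R] of [S]; functions that grow on [S] then drive the curvatures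
   to [-oo].  Finally, transport maps in both directions are merged, as in the
   Cantor-Bernstein theorem, into one of defect zero. *)

Require Import Defs.
From HB Require Import structures.
From mathcomp Require Import all_boot all_order all_algebra finmap.
From mathcomp Require Import all_classical all_reals all_analysis.
From mathcomp Require Import ring lra.
Import Order.TTheory GRing.Theory Num.Theory.
Local Open Scope classical_set_scope.
Local Open Scope ring_scope.

(** * Walks, distances and finiteness of balls *)

Lemma dist_leP (V : choiceType) (G : lfgraph V) (x y : V) (n : nat) :
  reflect (exists p : seq V, [/\ path G x p, last x p = y & (size p <= n)%N])
          (dist_le G x y n).
Proof.
apply: (iffP idP); rewrite /dist_le /dist; case: pselect => [h|h] //.
  case: ex_minnP => m /asboolP[p [xp py <-]] _ le_pn; by exists p.
  move=> [p [xp py le_pn]]; case: ex_minnP => m _ mmin.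
  by apply: leq_trans le_pn; apply: mmin; apply/asboolP; exists p.
by move=> [p [xp py le_pn]]; case: h; exists (size p); apply/asboolP; exists p.
Qed.

Lemma dist_le_refl (V : choiceType) (G : lfgraph V) (x : V) (n : nat) :
  dist_le G x x n.
Proof. by apply/dist_leP; exists [::]. Qed.

Lemma dist_le_mono (V : choiceType) (G : lfgraph V) (x y : V) (m n : nat) :
  (m <= n)%N -> dist_le G x y m -> dist_le G x y n.
Proof.
move=> le_mn /dist_leP[p [xp py le_pm]]; apply/dist_leP; exists p; split=> //.
exact: leq_trans le_mn.
Qed.

Lemma dist_le_sym (V : choiceType) (G : lfgraph V) (x y : V) (n : nat) :
  dist_le G x y n -> dist_le G y x n.
Proof.
move=> /dist_leP[p [xp py le_pn]]; apply/dist_leP; exists (rev (belast x p)).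
split; last by rewrite size_rev size_belast.
  rewrite -py rev_path; apply: sub_path xp => u v; by rewrite adj_sym.
by case: p py {xp le_pn} => [|a p _] //=; rewrite rev_cons last_rcons.
Qed.

Lemma gball1P (V : choiceType) (G : lfgraph V) (x y : V) :
  gball G 1 x y <-> x = y \/ G x y.
Proof.
split=> [/dist_leP[[|z [|t p]] [] //=]|[->|Gxy]].
- by left.
- by rewrite andbT => Gxz <- _; right.
- exact: dist_le_refl.
- by apply/dist_leP; exists [:: y]; split=> //=; rewrite Gxy.
Qed.

Lemma finite_gball (V : choiceType) (G : lfgraph V) (n : nat) (x : V) :
  finite_set (gball G n x).
Proof.
elim: n x => [|n IHn] x.
  apply: (@sub_finite_set _ _ [set x]) => // y /dist_leP[[|z p] [_ /= <-]] //.
apply: (@sub_finite_set _ _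
  ([set x] `|` \bigcup_(z in [set z | G x z]) gball G n z)).
  move=> y /dist_leP[[|z p] []] /=; first by move=> _ <- _; left.
  move=> /andP[Gxz zp] py le_pn; right; exists z => //; apply/dist_leP.
  by exists p.
rewrite finite_setU; split; first exact: finite_set1.
by apply: bigcup_finite => [|z _]; [exact: adj_locally_finite|exact: IHn].
Qed.

Lemma in_fball (V : choiceType) (G : lfgraph V) (n : nat) (x z : V) :
  (z \in fset_set (gball G n x)) = dist_le G x z n.
Proof.
by rewrite in_fset_set ?mem_setE //; exact: finite_gball.
Qed.

(** * Hall's marriage theorem and Hall violators *)

(** Halmos-Vaughan induction on the size of [X]. If a nonempty proper subset [S] has exactly [|S|]
    neighbours, [S] and its complement are matched separately. Otherwise every such subset has a
    neighbour to spare, and any single edge may be matched first. *)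
Lemma hall_marriage (V : choiceType) (e : rel V) (X Y : {fset V}) :
  (forall S, (S `<=` X)%fset ->
     (#|` S| <= #|` [fset z in Y | has (e^~ z) S]%fset|)%N) ->
  exists f : V -> V, {in X &, injective f} /\
    {in X, forall w, (f w \in Y) && e w (f w)}.
Proof.
have [n] := ubnP #|` X|; elim: n X Y => // n IHn X Y; rewrite ltnS => leXn hall.
have [X0|[w wX]] := fset_0Vmem X.
  by exists id; split=> w; rewrite X0 ?inE.
have [tight|slack] := pselect (exists S : {fset V}, [/\ (S `<` X)%fset,
    S != fset0 & #|` S| = #|` [fset z in Y | has (e^~ z) S]%fset|]).
  have [S [SX S0 cS]] := tight; have SsX := fproper_sub SX.
  set N := [fset z in Y | has (e^~ z) S]%fset in cS.
  have [||f [finj fe]] := IHn S Y.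
  - exact: leq_trans (fproper_ltn_card SX) leXn.
  - by move=> S' S'S; exact/hall/(fsubset_trans S'S).
  have [||g [ginj ge]] := IHn (X `\` S)%fset (Y `\` N)%fset.
  - apply: leq_trans leXn; rewrite cardfsDS //.
    by rewrite -[leqRHS]subn0 ltn_sub2l // cardfs_gt0 //; apply/fset0Pn; exists w.
  - move=> S' S'XS.
    have S'S0 : [disjoint S' & S]%fset.
      apply/fdisjointP => v /(fsubsetP S'XS); by rewrite inE => /andP[].
    (* Hall's condition survives the removal of [S] and [N]: apply it to the disjoint union of [S']
       and [S], then cancel the equal cardinalities of [S] and [N]. *)
    have /hall : (S' `|` S `<=` X)%fset.
      rewrite fsubUset SsX andbT; apply: (fsubset_trans S'XS); exact: fsubsetDl.
    rewrite cardfsU; move: S'S0; rewrite -fsetI_eq0 => /eqP->.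
    rewrite cardfs0 subn0 cS.
    set M := [fset z in (Y `\` N)%fset | has (e^~ z) S']%fset.
    have -> : [fset z in Y | has (e^~ z) (S' `|` S)%fset]%fset = (M `|` N)%fset.
      apply/fsetP => z; rewrite /M /N !inE /=.
      have -> : has (e^~ z) (S' `|` S)%fset = has (e^~ z) S' || has (e^~ z) S.
        apply/hasP/orP => [[v]|[/hasP|/hasP] [v vS ev]].
        - by rewrite inE => /orP[] vS ev; [left|right]; apply/hasP; exists v.
        - by exists v => //; rewrite inE vS.
        - by exists v => //; rewrite inE vS orbT.
      by case: (z \in Y); case: has; case: has.
    move=> h; rewrite -(leq_add2r #|` N|); apply: (leq_trans h).
    exact: leq_card_fsetU.
  exists (fun v => if v \in S then f v else g v); split=> [u v uX vX|v vX].
  (* [f] takes values in [N] and [g] outside it, so gluing them keeps injectivity. *)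
  - have gN t : t \in X -> t \notin S -> g t \notin N.
      by move=> tX tS; have /andP[] := ge t ltac:(by rewrite inE tS); rewrite inE => /andP[].
    have fN t : t \in S -> f t \in N.
      move=> tS; have /andP[fY et] := fe t tS.
      by rewrite !inE fY; apply/hasP; exists t.
    case: ifPn => uS; case: ifPn => vS.
    + exact: finj.
    + by move=> fg; have := gN v vX vS; rewrite -fg fN.
    + by move=> fg; have := gN u uX uS; rewrite fg fN.
    + by apply: ginj; rewrite inE ?uS ?vS.
  - case: ifPn => vS; first exact: fe.
    have /andP[] := ge v ltac:(by rewrite inE vS).
    by rewrite inE => /andP[_ ->].
have /hall : ([fset w] `<=` X)%fset by rewrite fsub1set.
rewrite cardfs1 cardfs_gt0 => /fset0Pn[b]; rewrite !inE /= => /andP[bY].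
move=> /hasP[w' + ewb]; rewrite inE => /eqP w'w; rewrite {}w'w in ewb.
have [||g [ginj ge]] := IHn (X `\ w)%fset (Y `\ b)%fset.
- by move: leXn; rewrite (cardfsD1 w X) wX.
- move=> S SX.
  have [->|S0] := eqVneq S fset0; first by rewrite cardfs0.
  have SpX : (S `<` X)%fset.
    exact: fsub_proper_trans SX (fproperD1 wX).
  set M := [fset _ in _ | _]%fset.
  set N := [fset z in Y | has (e^~ z) S]%fset.
  have NM : (N `<=` b |` M)%fset.
    apply/fsubsetP => z; rewrite !inE => /andP[-> ->].
    by case: eqVneq.
  (* Strictness comes from the absence of a tight subset; it pays for the loss of [b]. *)
  have ltSN : (#|` S| < #|` N|)%N.
    rewrite ltn_neqAle hall ?fproper_sub// andbT; apply/eqP => SN.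
    by apply: slack; exists S.
  rewrite -ltnS; apply: (leq_trans ltSN).
  apply: (leq_trans (fsubset_leq_card NM)).
  by rewrite cardfsU1 -add1n leq_add2r; case: (_ \notin _).
exists (fun v => if v == w then b else g v); split=> [u v uX vX|v vX].
- have gb t : t \in X -> t != w -> g t != b.
    by move=> tX tS; have /andP[] := ge t ltac:(by rewrite !inE tS); rewrite !inE => /andP[].
  case: (eqVneq u w) => [->|uw]; case: (eqVneq v w) => [->|vw] //.
  + by move=> bg; have := gb v vX vw; rewrite -bg eqxx.
  + by move=> bg; have := gb u uX uw; rewrite bg eqxx.
  + by apply: ginj; rewrite !inE ?uw ?vw.
- case: eqVneq => [->|vw]; first by rewrite bY.
  have /andP[] := ge v ltac:(by rewrite !inE vw).
  by rewrite !inE => /andP[_ ->].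
Qed.

(** The neighbourhood of [S] in the bipartite graph to which Hall's theorem is applied. *)
Definition rneighbors (V : choiceType) (G : lfgraph V) (rad : nat) (x : V)
    (S : {fset V}) : {fset V} :=
  [fset z in fset_set (gball G 1 x) | has (fun w => dist_le G w z rad) S]%fset.

(** A matching of the smallest admissible domain, [B_1(y)] minus the [rad]-ball of [x], would
    already be a transport map, so Hall's condition must fail there. *)
Lemma no_transport_hall_violator (V : choiceType) (G : lfgraph V) (rad : nat)
    (x y : V) :
  ~ has_transport_map G rad y x ->
  exists S : {fset V},
    [/\ S != fset0,
        {in S, forall w, dist_le G y w 1 /\ ~~ dist_le G x w rad} &
        (#|` rneighbors V G rad x S| < #|` S|)%N].
Proof.
move=> noT; apply: contrapT => noS; apply: noT.
have finB := finite_gball V G.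
have finX : finite_set (gball G 1 y `\` gball G rad x) by exact: finite_setD.
set X := fset_set (gball G 1 y `\` gball G rad x).
have inX w : w \in X -> dist_le G y w 1 /\ ~~ dist_le G x w rad.
  by rewrite in_fset_set// inE => -[yw xw]; split=> //; exact/negP.
have [|f [finj fe]] := hall_marriage V (fun w z => dist_le G w z rad) X
    (fset_set (gball G 1 x)).
  move=> S SX; rewrite leqNgt; apply/negP => ltNS; apply: noS; exists S.
  split=> // [|w wS]; last exact/inX/(fsubsetP SX).
  by rewrite -cardfs_gt0; exact: leq_ltn_trans ltNS.
have memX w : (gball G 1 y `\` gball G rad x) w -> w \in X.
  by move=> Xw; rewrite in_fset_set// inE.
exists (gball G 1 y `\` gball G rad x), f; split=> //.
- by move=> _ [w /memX/fe/andP[fw _] <-]; move: fw; rewrite in_fball.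
- by move=> u v; rewrite !inE => /memX uX /memX vX; exact: finj.
- by move=> w /memX/fe/andP[].
Qed.

(** * The defect, and merging transport maps in both directions *)

Lemma map_defect_eq0 (V : choiceType) (G : lfgraph V) (rad : nat)
    (x y : V) (A : set V) (phi : V -> V) :
  map_defect G rad y x A phi = 0%N <->
  gball G 1 x `\` gball G rad y `<=` phi @` A.
Proof.
have finD : finite_set (gball G 1 x `\` (phi @` A `|` gball G rad y)).
  exact/finite_setD/finite_gball.
rewrite /map_defect; split=> [/cardfs0_eq D0 z [xz yz]|sub].
  apply: contrapT => Az.
  suff : z \in fset_set (gball G 1 x `\` (phi @` A `|` gball G rad y)).
    by rewrite D0.
  by rewrite in_fset_set// inE; split=> // -[].
rewrite [X in fset_set X](_ : _ = set0) ?fset_set0 ?cardfs0//.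
rewrite -subset0 => z [xz /not_orP[Az yz]].
by apply: Az; exact: sub.
Qed.

(** Defects of maps are natural numbers, so the infimum over a nonempty family is a minimum. *)
Lemma defect_attained (V : choiceType) (G : lfgraph V) (R : realType)
    (rad : nat) (x y : V) :
  has_transport_map G rad y x ->
  exists A phi, transport_map G rad y x A phi /\
    defect G R rad y x = ((map_defect G rad y x A phi)%:R)%:E.
Proof.
move=> [A0 [phi0 T0]].
pose P n := `[< exists A phi, transport_map G rad y x A phi /\
  map_defect G rad y x A phi = n >].
have exP : exists n, P n.
  by exists (map_defect G rad y x A0 phi0); apply/asboolP; exists A0, phi0.
case: (ex_minnP exP) => n /asboolP[A [phi [T defT]]] nmin.
exists A, phi; split=> //; apply/eqP; rewrite eq_le; apply/andP; split.
  by apply: ereal_inf_lbound; exists A, phi.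
apply: le_ereal_inf_tmp => _ [B [psi [T' ->]]]; rewrite lee_fin ler_nat defT.
by apply: nmin; apply/asboolP; exists B, psi.
Qed.

(** Defect zero says precisely that the image of [phi] is large enough to serve as the domain of the
    inverse map. *)
Lemma transport_map_inv (V : choiceType) (G : lfgraph V) (rad : nat)
    (x y : V) (A : set V) (phi : V -> V) :
  transport_map G rad y x A phi -> map_defect G rad y x A phi = 0%N ->
  has_transport_map G rad x y.
Proof.
move=> [AB AsB phiB phiI phid] /map_defect_eq0 sub.
have preim z : exists w, (phi @` A) z -> A w /\ phi w = z.
  have [[w Aw wz]|nz] := pselect ((phi @` A) z); first by exists w.
  by exists z.
have [psi psiP] := choice preim.
exists (phi @` A), psi; split=> //.
- by move=> _ [z /psiP[/AsB ? _] <-].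
- move=> u v; rewrite !inE => /psiP[_ eu] /psiP[_ ev] uv.
  by rewrite -eu -ev uv.
- by move=> z /psiP[Aw {1}<-]; exact/dist_le_sym/phid.
Qed.

(** The maps are total but meaningful only on [A] and [B], hence the membership conditions in the
    step. *)
Inductive swap_chain (T : Type) (A B : set T) (phi psi : T -> T) : T -> Prop :=
| SwapChainStart w of A w & ~ (psi @` B) w : swap_chain T A B phi psi w
| SwapChainStep w of swap_chain T A B phi psi w & A w & B (phi w) :
    swap_chain T A B phi psi (psi (phi w)).

(* Banach's proof of the Cantor-Bernstein theorem: use [phi] on the chains
   starting outside the range of [psi], and the inverse of [psi] elsewhere. *)
Lemma transport_maps_merge (V : choiceType) (G : lfgraph V) (rad : nat)
    (x y : V) :
  has_transport_map G rad y x -> has_transport_map G rad x y ->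
  exists A phi, transport_map G rad y x A phi /\
    map_defect G rad y x A phi = 0%N.
Proof.
move=> [A [phi [AB AsB phiB phiI phid]]] [B [psi [BB BsB psiB psiI psid]]].
pose P := swap_chain V A B phi psi.
have preim w : exists z, (psi @` B) w -> B z /\ psi z = w.
  have [[z Bz zw]|nw] := pselect ((psi @` B) w); first by exists z.
  by exists w.
have [psi' psi'P] := choice preim.
have psiK z : B z -> psi' (psi z) = z.
  move=> Bz; have [|Bz' eqz] := psi'P (psi z); first by exists z.
  by apply: psiI; rewrite ?inE.
pose C := (A `&` P) `|` (psi @` B `\` P).
pose chi w := if `[< P w >] then phi w else psi' w.
have chiP w : P w -> chi w = phi w by move=> Pw; rewrite /chi asboolT.
have chiN w : ~ P w -> chi w = psi' w by move=> Pw; rewrite /chi asboolF.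
(* The two branches of [chi] cannot collide: [phi w = psi' v] would give [v = psi (phi w)], putting
   [v] on the chain of [w]. *)
have clash w v : A w -> P w -> (psi @` B) v -> ~ P v -> phi w <> psi' v.
  move=> Aw Pw /psi'P[Bv ev] NPv eqwv; apply: NPv; rewrite -ev -eqwv.
  by apply: SwapChainStep => //; rewrite eqwv.
exists C, chi; split.
  split.
  - move=> w /AB Aw; have [Pw|NPw] := pselect (P w); first by left.
    right; split=> //; apply: contrapT => Bw; apply: NPw.
    exact: SwapChainStart.
  - by move=> w [[/AsB]|[Bw _]] //; exact: psiB.
  - move=> _ [w [[Aw Pw]|[Bw NPw]] <-].
      by rewrite chiP//; apply: phiB; exists w.
    by rewrite chiN//; have [/BsB] := psi'P w Bw.
  - move=> u v; rewrite !inE => -[[Au Pu]|[Bu NPu]] [[Av Pv]|[Bv NPv]].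
    + by rewrite !chiP//; apply: phiI; rewrite inE.
    + by rewrite chiP// chiN// => /(clash u v Au Pu Bv NPv).
    + by rewrite chiN// chiP// => /esym/(clash v u Av Pv Bu NPu).
    + rewrite !chiN// => uv.
      by have [_ <-] := psi'P u Bu; have [_ <-] := psi'P v Bv; rewrite uv.
  - move=> w [[Aw Pw]|[Bw NPw]]; first by rewrite chiP//; exact: phid.
    by rewrite chiN//; have [Bz {1}<-] := psi'P w Bw; exact/dist_le_sym/psid.
(* Such a [z] lies in [B]. If [psi z] is off the chains, [z] is its image under [chi]. Otherwise
   [psi z], being in the range of [psi], is no starting point, so [psi z = psi (phi w)] for an
   earlier [w] on the chain. *)
apply/map_defect_eq0 => z /BB Bz.
have [Pz|NPz] := pselect (P (psi z)); last first.
  by exists (psi z); [right; split=> //; exists z|rewrite chiN// psiK].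
move: Pz; move Ev : (psi z) => v Pz.
case: Pz Ev => [w _ nBw ew|w Pw Aw Bw eqz].
  by case: nBw; exists z.
have -> : z = phi w by apply: psiI; rewrite ?inE.
by exists w; [left|rewrite chiP].
Qed.

Lemma defect_eq0 (V : choiceType) (G : lfgraph V) (R : realType) (rad : nat)
    (x y : V) :
  defect G R rad y x = 0%E <->
  has_transport_map G rad y x /\ has_transport_map G rad x y.
Proof.
split=> [d0|[Tyx Txy]].
  have Tyx : has_transport_map G rad y x.
    apply: contrapT => noT; move: d0; rewrite /defect.
    (* Without transport maps the infimum is over the empty set and equals [+oo], not 0. *)
    rewrite [X in ereal_inf X](_ : _ = set0) ?ereal_inf0//.
    by rewrite -subset0 => d [A [phi [T _]]]; apply: noT; exists A, phi.
  split=> //; have [A [phi [T]]] := defect_attained V G R rad x y Tyx.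
  rewrite d0 => -[/esym/eqP]; rewrite pnatr_eq0 => /eqP.
  exact: transport_map_inv T.
have [A [phi [T defT]]] := transport_maps_merge V G rad x y Tyx Txy.
apply/eqP; rewrite eq_le; apply/andP; split.
  by apply: ereal_inf_lbound; exists A, phi; rewrite defT.
by apply: le_ereal_inf_tmp => _ [B [psi [_ ->]]]; rewrite lee_fin.
Qed.

(** * Sums over balls, gradients and the transport inequality *)

Lemma sum_fset_ge (R : numDomainType) (I : choiceType) (A : {fset I})
    (F : I -> R) (c : R) :
  {in A, forall i, c <= F i} -> c * (#|` A|%fset)%:R <= \sum_(i <- A) F i.
Proof.
move=> cF; have -> : c * (#|` A|)%:R = \sum_(i <- A) c.
  by rewrite big_const_seq count_predT iter_addr_0 mulr_natr.
by rewrite big_seq [leRHS]big_seq; apply: ler_sum.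
Qed.

(** The added term at the centre vanishes; the sum then runs over the ball in which transport maps
    live. *)
Lemma lap_ballE (R : realType) (V : choiceType) (G : lfgraph V) (f : V -> R)
    (x : V) :
  lap G f x = \sum_(z <- fset_set (gball G 1 x)) (f z - f x).
Proof.
rewrite /lap fsbig_finite; last exact: adj_locally_finite.
rewrite [RHS](big_fsetD1 x) /=; last by rewrite in_fball dist_le_refl.
rewrite subrr add0r; apply: eq_fbigl => z.
rewrite in_fset_set; last exact: adj_locally_finite.
rewrite !inE in_fball; apply/idP/andP => [|[zx /gball1P[xz|]]].
  rewrite mem_setE /= => Gxz; split; last by apply/gball1P; right.
  by apply/eqP => zx; move: (Gxz : G x z); rewrite zx adj_irr.
  by rewrite xz eqxx in zx.
by rewrite mem_setE.
Qed.

Lemma grad_ge (R : realType) (V : choiceType) (G : lfgraph V) (rad : nat)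
    (f : V -> R) (z w : V) :
  dist_le G z w rad -> `|f w - f z| <= grad G rad f z.
Proof.
move=> zw; apply: ub_le_sup; last by exists w.
(* The sum of all differences over the finite ball is a crude upper bound, which [ub_le_sup]
   requires. *)
exists (\sum_(v <- fset_set (gball G rad z)) `|f v - f z|) => _ [v zv <-].
rewrite (big_fsetD1 v) /=; last by rewrite in_fball.
by rewrite lerDl; apply: sumr_ge0.
Qed.

Lemma grad_le (R : realType) (V : choiceType) (G : lfgraph V) (rad : nat)
    (f : V -> R) (z : V) (c : R) :
  (forall w, dist_le G z w rad -> `|f w - f z| <= c) -> grad G rad f z <= c.
Proof.
move=> fc; apply: ge_sup => [|_ [w zw <-]]; last exact: fc.
by exists `|f z - f z|, z => //; exact: dist_le_refl.
Qed.

(** The common core of the three lower bounds. Terms of [S] on [A] are paid for by terms of [T] on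
    the image of [phi], and each point of the defect costs at most [C]. *)
Lemma transport_sum_ge (R : realType) (V : choiceType) (G : lfgraph V)
    (rad : nat) (x y : V) (A : set V) (phi : V -> V) (T S : V -> R) (C : R) :
  transport_map G rad y x A phi ->
  (forall w, A w -> S w <= T (phi w)) ->
  (forall w, dist_le G y w 1 -> dist_le G x w rad -> S w <= 0) ->
  (forall z, dist_le G x z 1 -> dist_le G y z rad -> 0 <= T z) ->
  (forall z, dist_le G x z 1 -> - C <= T z) ->
  - C * (map_defect G rad y x A phi)%:R <=
  \sum_(z <- fset_set (gball G 1 x)) T z
  - \sum_(w <- fset_set (gball G 1 y)) S w.
Proof.
move=> [AB AsB phiB phiI _] ST S_le0 T_ge0 T_geC.
have finA : finite_set A by exact: sub_finite_set AsB (finite_gball V G 1 y).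
have inA w : (w \in fset_set A) = `[< A w >] by rewrite in_fset_set.
set D := fset_set (gball G 1 x `\` (phi @` A `|` gball G rad y)).
have inD z : (z \in D) = `[< (gball G 1 x `\` (phi @` A `|` gball G rad y)) z >].
  by rewrite in_fset_set//; exact/finite_setD/finite_gball.
have leS : \sum_(w <- fset_set (gball G 1 y)) S w <=
    \sum_(w <- fset_set A) T (phi w).
  rewrite (big_fsetID _ (fun w => w \in fset_set A)) /= -[leRHS]addr0.
  apply: lerD.
    rewrite [leLHS](eq_fbigl _ _ (B := fset_set A)); last first.
      move=> w; rewrite !inE /= in_fball inA; apply/andP/idP => [[]//|].
      by move=> /[dup] /asboolP/AsB.
    rewrite big_seq [leRHS]big_seq; apply: ler_sum => w.
    by rewrite inA => /asboolP; exact: ST.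
  (* A point of [B_1(y)] outside [A] lies in the [rad]-ball of [x], where [S] is nonpositive. *)
  rewrite big_seq; apply: sumr_le0 => w; rewrite !inE /= in_fball inA.
  move=> /andP[yw /asboolP NAw]; apply: S_le0 => //; apply: contrapT => xw.
  by apply: NAw; apply: AB; split.
have leT : \sum_(w <- fset_set A) T (phi w) - C * (#|` D|)%:R <=
    \sum_(z <- fset_set (gball G 1 x)) T z.
  rewrite [leRHS](big_fsetID _ (fun z => z \in (phi @` fset_set A)%fset)) /=.
  have inphi z : z \in (phi @` fset_set A)%fset -> (phi @` A) z.
    by move=> /imfsetP[w /=]; rewrite inA => /asboolP Aw ->; exists w.
  apply: lerD.
    rewrite [leRHS](eq_fbigl _ _ (B := (phi @` fset_set A)%fset)); last first.
      move=> z; rewrite !inE /= in_fball; apply/andP/idP => [[]//|].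
      by move=> zA; split=> //; apply: phiB; exact: inphi.
    rewrite big_imfset//= => u v; rewrite !inA => Au Av.
    by apply: phiI; rewrite inE; exact/asboolP.
  rewrite [leRHS](big_fsetID _ (fun z => z \in D)) /= -[leLHS]addr0.
  apply: lerD.
    rewrite [leRHS](eq_fbigl _ _ (B := D)); last first.
      move=> z; rewrite !inE /= in_fball inD; apply/andP/idP => [[]//|].
      move=> /[dup] Dz /asboolP[xz nz]; split=> //; rewrite xz /=.
      by apply/negP => /inphi phiz; apply: nz; left.
    rewrite -mulNr; apply: sum_fset_ge => z.
    by rewrite inD => /asboolP[xz _]; exact: T_geC.
  (* A point of [B_1(x)] outside both the image and [D] lies in the [rad]-ball of [y], where [T] is
     nonnegative. *)
  rewrite big_seq; apply: sumr_ge0 => z; rewrite !inE /= in_fball inD.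
  move=> /andP[/andP[xz phiz] /asboolP nz]; apply: T_ge0 => //.
  apply: contrapT => yz; apply: nz; split=> // -[[w Aw wz]|//].
  by move/negP: phiz; apply; apply/imfsetP; exists w => //=; rewrite inA; apply/asboolP.
by rewrite mulNr lerBrDr; apply: le_trans leT; rewrite addrC lerD2r.
Qed.

(** * Lower bounds of the curvatures by the defect *)

Lemma norm_eq1 (R : realDomainType) (a : R) : `|a| = 1 -> a = 1 \/ a = -1.
Proof. by case: ger0P => _ <-; [left|right; rewrite opprK]. Qed.

(** The sign [s] makes [s * f] rise by 1 from [x] to [y]. The transport hypothesis then reduces to
    [s * (f w - f (phi w))] being at most the gradient at [phi w]. *)
Lemma curv_ge (R : realType) (V : choiceType) (G : lfgraph V) (rad : nat)
    (x y : V) (A : set V) (phi : V -> V) :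
  (1 <= rad)%N -> transport_map G rad y x A phi ->
  ((- (map_defect G rad y x A phi)%:R)%:E <= curv R G rad x y)%E.
Proof.
move=> rad1 T; apply: le_ereal_inf_tmp => _ [f [gx fxy] <-]; rewrite lee_fin.
rewrite gx in fxy; rewrite !lap_ballE gx.
set s := Num.sg _.
have sf u v : dist_le G u v rad -> s * (f v - f u) <= grad G rad f u.
  move=> uv; apply: le_trans (grad_ge _ _ _ _ f _ _ uv).
  rewrite /s; case: (norm_eq1 _ _ fxy) => ->; rewrite ?sgrN1 ?sgr1 ?mul1r ?mulN1r.
    exact: ler_norm.
  by rewrite -normrN ler_norm.
have sxy : s * (f y - f x) = 1.
  by rewrite /s; case: (norm_eq1 _ _ fxy) => ->; rewrite ?sgrN1 ?sgr1 ?mulrNN mulr1.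
have [_ _ _ _ phid] := T.
have := transport_sum_ge R V G rad x y A phi
  (fun z => grad G rad f z - 1 + s * (f z - f x)) (fun w => s * (f w - f y)) 1 T.
rewrite big_split /= -!mulr_sumr mulN1r.
move=> H; have /H{H} : forall w, A w -> s * (f w - f y) <=
    grad G rad f (phi w) - 1 + s * (f (phi w) - f x).
  by move=> w /phid/dist_le_sym/sf; lra.
move=> H; have /H{H} : forall w, dist_le G y w 1 -> dist_le G x w rad ->
    s * (f w - f y) <= 0.
  by move=> w _ /sf; rewrite gx; lra.
move=> H; have /H{H} : forall z, dist_le G x z 1 -> dist_le G y z rad ->
    0 <= grad G rad f z - 1 + s * (f z - f x).
  by move=> z _ /dist_le_sym/sf; lra.
move=> H; have /H{H} : forall z, dist_le G x z 1 ->
    - 1 <= grad G rad f z - 1 + s * (f z - f x).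
  by move=> z /(dist_le_mono _ _ _ _ _ _ rad1)/dist_le_sym/sf; lra.
by lra.
Qed.

(** The terms are [expR] of increments minus 1. Since [g] rises by exactly [r] from [x] to [y],
    comparing them amounts to [g w - g (phi w) <= r]. On the defect, [1 + t <= expR t] gives at
    least [- r], which the factor [r^-1] turns into [- 1]. *)
Lemma curv_e_ge (R : realType) (V : choiceType) (G : lfgraph V) (rad : nat)
    (x y : V) (A : set V) (phi : V -> V) :
  (1 <= rad)%N -> transport_map G rad y x A phi ->
  ((- (map_defect G rad y x A phi)%:R)%:E <= curv_e R G rad x y)%E.
Proof.
move=> rad1 T; apply: le_ereal_inf_tmp => _ [r /= r0 <-].
rewrite lee_pdivlMl//; apply: le_ereal_inf_tmp => _ [g [gr gxy] <-].
rewrite -EFinM lee_fin !lap_ballE.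
have gD u v : dist_le G u v rad -> g v - g u <= r.
  move=> uv; apply: le_trans (ler_norm _) _.
  apply: le_trans (grad_ge _ _ _ _ _ _ _ uv) _.
  by rewrite -lee_fin -gr; apply: ereal_sup_ubound; exists u.
have expE v w : (expR (g w) - expR (g v)) / expR (g v) = expR (g w - g v) - 1.
  by rewrite mulrBl divff ?gt_eqF ?expR_gt0// expRD expRN.
rewrite !mulr_suml.
under eq_bigr do rewrite expE.
under [X in _ - X]eq_bigr do rewrite expE.
have [_ _ _ _ phid] := T.
have := transport_sum_ge R V G rad x y A phi
  (fun z => expR (g z - g x) - 1) (fun w => expR (g w - g y) - 1) r T.
rewrite mulrN -mulNr; apply.
- by move=> w /phid/dist_le_sym/gD ?; rewrite lerD2r ler_expR; lra.
- by move=> w _ /gD ?; rewrite subr_le0 -expR0 ler_expR; lra.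
- by move=> z _ /dist_le_sym/gD ?; rewrite subr_ge0 -expR0 ler_expR; lra.
- move=> z /(dist_le_mono _ _ _ _ _ _ rad1)/dist_le_sym/gD ?.
  rewrite lerBrDl; apply: le_trans (expR_ge1Dx _) _.
  by rewrite ler_expR; lra.
Qed.

(* The Cauchy-Schwarz inequality [(u + D)^2 / (a + 1) <= u^2 / a + D^2]. *)
Lemma square_transport (R : realFieldType) (a b D u v : R) :
  b = a + 1 -> 0 < a -> 0 < u -> 0 < v -> 0 <= D -> v <= u + D ->
  (v ^+ 2 - b ^+ 2) / b <= D ^+ 2 - 1 + (u ^+ 2 - a ^+ 2) / a.
Proof.
move=> -> a0 u0 v0 D0 vuD.
have ltv : v ^+ 2 <= (u + D) ^+ 2 by rewrite ler_pXn2r// nnegrE; lra.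
have a1 : 0 < a + 1 by lra.
rewrite ler_pdivrMr//.
have -> : (D ^+ 2 - 1 + (u ^+ 2 - a ^+ 2) / a) * (a + 1) =
  (u + D) ^+ 2 - (a + 1) ^+ 2 + (a * D - u) ^+ 2 / a.
  by field; rewrite gt_eqF.
have : 0 <= (a * D - u) ^+ 2 / a by rewrite divr_ge0 ?sqr_ge0 ?ltW.
lra.
Qed.

(** [square_transport] compares the terms, with the smaller of [g x] and [g y] as its [a]. Each
    defect point costs at most 3, halved by the factor in [curv_q]. *)
Lemma curv_q_ge (R : realType) (V : choiceType) (G : lfgraph V) (rad : nat)
    (x y : V) (A : set V) (phi : V -> V) :
  (1 <= rad)%N -> transport_map G rad y x A phi ->
  ((- (3 / 2 * (map_defect G rad y x A phi)%:R))%:E <= curv_q R G rad x y)%E.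
Proof.
move=> rad1 T; rewrite /curv_q lee_pdivlMl//.
apply: le_ereal_inf_tmp => _ [g [g0 gx gxy] <-]; rewrite -EFinM lee_fin.
rewrite !lap_ballE gx expr1n.
set D := grad G rad g.
have D0 z : 0 <= D z.
  apply: le_trans (grad_ge _ _ _ _ g _ _ (dist_le_refl _ G z rad)).
  exact: normr_ge0.
have gD u v : dist_le G u v rad -> g v <= g u + D u /\ g u <= g v + D u.
  by move=> uv; have := grad_ge _ _ _ _ g _ _ uv; rewrite ler_norml /D; lra.
rewrite !mulr_suml.
have [_ _ _ _ phid] := T.
pose s : R := Num.sg (g y - g x).
have := transport_sum_ge R V G rad x y A phi
  (fun z => D z ^+ 2 - 1 + s * ((g z ^+ 2 - g x ^+ 2) / g x))
  (fun w => s * ((g w ^+ 2 - g y ^+ 2) / g y)) 3 T.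
rewrite big_split /= -!mulr_sumr -/s => H.
suff : - 3 * (map_defect G rad y x A phi)%:R <=
  \sum_(z <- fset_set (gball G 1 x)) (D z ^+ 2 - 1) +
  s * (\sum_(z <- fset_set (gball G 1 x)) (g z ^+ 2 - g x ^+ 2) / g x) -
  s * (\sum_(z <- fset_set (gball G 1 y)) (g z ^+ 2 - g y ^+ 2) / g y).
  by lra.
have a0 := g0 x; have b0 := g0 y.
have sqdiv0 (a : R) : (a ^+ 2 - a ^+ 2) / a = 0 by rewrite subrr mul0r.
have gDx z : dist_le G x z 1 -> g x <= g z + D z /\ g z <= g x + D z.
  by move=> /(dist_le_mono _ _ _ _ _ _ rad1)/dist_le_sym/gD.
have gDx1 w : dist_le G x w rad -> g w <= g x + 1 /\ g x <= g w + 1.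
  by move=> /gD; rewrite /D gx.
rewrite {}/s in H *.
case: (norm_eq1 _ _ gxy) H => /[dup] eqxy ->; rewrite ?sgr1 ?sgrN1; apply.
- move=> w /phid/dist_le_sym/gD[? _]; rewrite !mul1r.
  by apply: square_transport => //; lra.
- move=> w _ /gDx1[? _]; rewrite mul1r.
  rewrite (le_trans (square_transport _ (g x) _ 1 (g x) _ _ _ _ _ _ _))//; lra.
- move=> z _ /dist_le_sym/gD[? _]; rewrite mul1r.
  by rewrite -(sqdiv0 (g y)); apply: square_transport => //; lra.
(* If [g] rises from [x] to [y], comparison with the value [g x] gives at least
   [- (2 * g x + 1) / (g x + 1)], which exceeds [- 2]. *)
- move=> z /gDx[? _]; rewrite mul1r.
  apply: (le_trans _ (square_transport _ (g x) (g y) _ _ (g x) _ _ _ _ _ _)) => //; last lra.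
  have eqy : g y = g x + 1 by lra.
  by rewrite ler_pdivlMr // eqy; nra.
(* If [g] falls from [x] to [y], the roles of [x] and [y], and of [w] and [phi w], are exchanged in
   [square_transport]. *)
- move=> w /phid/dist_le_sym/gD[_ ?]; rewrite !mulN1r.
  have /(_ (D (phi w)) (g w) (g (phi w))) := square_transport _ (g y) (g x).
  by move=> h; have := h ltac:(lra) b0 (g0 _) (g0 _) (D0 _) ltac:(lra); lra.
- move=> w _ /gDx1[_ ?]; rewrite mulN1r.
  have /(_ 1 (g w) (g x)) := square_transport _ (g y) (g x).
  by move=> h; have := h ltac:(lra) b0 (g0 _) (g0 _) ltac:(lra) ltac:(lra); rewrite sqdiv0; lra.
- move=> z _ /dist_le_sym/gD[_ ?]; rewrite mulN1r.
  have /(_ (D z) (g y) (g z)) := square_transport _ (g y) (g x).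
  by move=> h; have := h ltac:(lra) b0 (g0 _) (g0 _) (D0 _) ltac:(lra); rewrite sqdiv0; lra.
(* The constant 3 arises here: [g x = g y + 1] exceeds 1, so [t ^+ 2 / g x] is absorbed by
   [D z ^+ 2], and [t <= 1] leaves [- 1 - 2]. *)
- move=> z xz; have [? ?] := gDx z xz; rewrite mulN1r.
  have [? ?] := gDx1 z (dist_le_mono _ _ _ _ _ _ rad1 xz).
  set t := g z - g x.
  have -> : (g z ^+ 2 - g x ^+ 2) / g x = 2 * t + t ^+ 2 / g x.
    by rewrite /t; field; rewrite gt_eqF.
  have tD : t ^+ 2 <= D z ^+ 2.
    by rewrite -[leLHS]real_normK ?num_real// ler_pXn2r ?nnegrE// ler_norml /t; lra.
  have : t ^+ 2 / g x <= t ^+ 2 by rewrite ler_piMr ?sqr_ge0// invf_le1//; lra.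
  by rewrite /t in tD *; lra.
Qed.

(** * Test functions from Hall violators, and unboundedness below *)

Lemma sum_fset_indic (R : numDomainType) (I : choiceType) (A B : {fset I})
    (c : R) :
  (B `<=` A)%fset ->
  \sum_(i <- A) c * (i \in B)%:R = c * (#|` B|%fset)%:R.
Proof.
move=> BA; rewrite -(big_fset_incl _ BA); last first.
  by move=> i _ /negbTE->; rewrite mulr0.
rewrite big_seq (eq_bigr (fun=> c)); last by move=> i ->; rewrite mulr1.
by rewrite -big_seq big_const_seq count_predT iter_addr_0 mulr_natr.
Qed.

(** Here [al] and [be] are the large contributions on [N] and on [S], and [c] absorbs everything
    bounded. As [S] has at least one point more than [N], taking [al] and [be] large and nearly
    equal makes the bound tend to [-oo]. *)
Lemma hall_violator_sum_le (R : realType) (V : choiceType) (G : lfgraph V)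
    (rad : nat) (x y : V) (S : {fset V}) (N := rneighbors V G rad x S)
    (T U : V -> R) (al be c : R) :
  {in S, forall w, dist_le G y w 1 /\ ~~ dist_le G x w rad} ->
  (#|` N| < #|` S|)%N -> 0 <= be ->
  (forall z, dist_le G x z 1 -> T z <= al * (z \in N)%:R + c) ->
  (forall w, dist_le G y w 1 -> be * (w \in S)%:R - c <= U w) ->
  \sum_(z <- fset_set (gball G 1 x)) T z
  - \sum_(w <- fset_set (gball G 1 y)) U w
  <= al * (#|` N|)%:R - be * (#|` N|.+1)%:R
     + c * (#|` fset_set (gball G 1 x)| + #|` fset_set (gball G 1 y)|)%:R.
Proof.
move=> SP ltNS be0 leT leU.
have SB : (S `<=` fset_set (gball G 1 y))%fset.
  by apply/fsubsetP => w /SP[yw _]; rewrite in_fball.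
have NB : (N `<=` fset_set (gball G 1 x))%fset.
  by apply/fsubsetP => z; rewrite !inE => /andP[].
have leST : \sum_(z <- fset_set (gball G 1 x)) T z <=
    al * (#|` N|)%:R + c * (#|` fset_set (gball G 1 x)|)%:R.
  rewrite -(sum_fset_indic _ _ _ _ _ NB).
  rewrite -(sum_fset_indic _ _ _ _ c (fsubset_refl (fset_set (gball G 1 x)))).
  rewrite -big_split big_seq [leRHS]big_seq; apply: ler_sum => z zx /=.
  by rewrite zx mulr1; apply: leT; rewrite -in_fball.
have leSU : be * (#|` S|)%:R - c * (#|` fset_set (gball G 1 y)|)%:R <=
    \sum_(w <- fset_set (gball G 1 y)) U w.
  rewrite -(sum_fset_indic _ _ _ _ _ SB).
  rewrite -(sum_fset_indic _ _ _ _ c (fsubset_refl (fset_set (gball G 1 y)))).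
  rewrite -sumrB big_seq [leRHS]big_seq; apply: ler_sum => w wy /=.
  by rewrite wy mulr1; apply: leU; rewrite -in_fball.
have leNS : be * (#|` N|.+1)%:R <= be * (#|` S|)%:R.
  by rewrite ler_wpM2l// ler_nat.
by rewrite natrD; lra.
Qed.

(** The unit bump at [y] normalises the gradient at [x], the height [M] on [S] is sent to infinity,
    and the base level [a] is left free because [curv_q] needs positive functions. *)
Definition spike (R : realType) (V : choiceType) (S : {fset V}) (y : V)
    (a M : R) (z : V) : R :=
  a + (z == y)%:R + M * (z \in S)%:R.

(** [S] avoids the [rad]-ball of [x], so the gradient at [x] sees only the bump; at other points of
    [B_1(x)] it sees the height [M] only if they lie within [rad] of [S]. *)
Lemma spike_spec (R : realType) (V : choiceType) (G : lfgraph V) (rad : nat)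
    (x y : V) (S : {fset V}) (a M : R) (g := spike R V S y a M) :
  (1 <= rad)%N -> dist_le G x y rad -> 1 <= M ->
  {in S, forall w, dist_le G y w 1 /\ ~~ dist_le G x w rad} ->
  S != fset0 ->
  [/\ g x = a, g y = a + 1, grad G rad g x = 1,
      forall z, dist_le G x z 1 -> a <= g z <= a + 1 &
      forall z, dist_le G x z 1 -> 0 <= grad G rad g z <=
        if z \in rneighbors V G rad x S then M else 1].
Proof.
move=> rad1 xy M1 SP /fset0Pn[w0 w0S].
have nS z : dist_le G x z rad -> z \notin S.
  by move=> xz; apply/negP => /SP[_]; rewrite xz.
(* If [x = y], then [B_1(y)] is inside the [rad]-ball of [x] and leaves no room for a point of
   [S]. *)
have nxy : (x == y) = false.
  apply/negP => /eqP exy; have [yw] := SP _ w0S.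
  by rewrite exy (dist_le_mono _ _ _ _ _ _ rad1 yw).
have gnS z : z \notin S -> g z = a + (z == y)%:R.
  by move=> zS; rewrite /g /spike (negbTE zS) mulr0 addr0.
have gx : g x = a by rewrite gnS ?nS ?dist_le_refl// nxy addr0.
have gy : g y = a + 1 by rewrite gnS ?nS// eqxx.
have gS z : z \notin S -> a <= g z <= a + 1.
  by move=> /gnS->; case: (z == y) => /=; lra.
have gM z : a <= g z <= a + M.
  have [zS|/gS] := boolP (z \in S); last lra.
  rewrite /g /spike zS mulr1.
  have -> : (z == y) = false by apply/negP => /eqP zy; move: (nS y xy); rewrite -zy zS.
  by rewrite addr0; lra.
have B1 z : dist_le G x z 1 -> z \notin S.
  by move=> /(dist_le_mono _ _ _ _ _ _ rad1)/nS.
split=> // [|z /B1/gS//|z xz].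
  apply/eqP; rewrite eq_le; apply/andP; split.
    apply: grad_le => w /nS/gS; rewrite gx ler_norml; lra.
  apply: le_trans (grad_ge _ _ _ _ _ _ _ xy).
  by rewrite gx gy addrAC subrr add0r normr1.
apply/andP; split.
  exact: le_trans (normr_ge0 _) (grad_ge _ _ _ _ g _ _ (dist_le_refl _ G z rad)).
have [zN|zN] := boolP (z \in rneighbors _ _ _ _ _); apply: grad_le => w zw.
  by have := gM z; have := gM w; rewrite ler_norml; lra.
have wS : w \notin S.
  apply: contra zN => wS; rewrite !inE /= in_fball xz /=; apply/hasP.
  by exists w => //; exact: dist_le_sym.
by have := gS z (B1 z xz); have := gS w wS; rewrite ler_norml; lra.
Qed.

Lemma curv_eqNy (R : realType) (V : choiceType) (G : lfgraph V) (rad : nat)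
    (x y : V) :
  (1 <= rad)%N -> dist_le G x y rad -> ~ has_transport_map G rad y x ->
  curv R G rad x y = -oo%E.
Proof.
move=> rad1 xy noT.
have [S [S0 SP ltNS]] := no_transport_hall_violator V G rad x y noT.
set K : R := (#|` fset_set (gball G 1 x)| + #|` fset_set (gball G 1 y)|)%:R.
apply: eq_ninfty => t.
(* With [n] points in [N], the total is at most [M * n - M * (n + 1) + K = K - M]. *)
pose M : R := Num.max 1 (K - t).
have M1 : 1 <= M by rewrite /M le_max lexx.
have Mt : K - t <= M by rewrite /M le_max lexx orbT.
have [fx fy gx fB gB] := spike_spec R V G rad x y S 0 M rad1 xy M1 SP S0.
set f := spike _ _ _ _ _ _ in fx fy gx fB gB.
have fxy : f y - f x = 1 by rewrite fx fy; lra.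
apply: ge_ereal_inf; eexists.
  exists f => //=; split=> //; by rewrite gx fxy normr1.
rewrite lee_fin !lap_ballE gx fxy sgr1.
have := hall_violator_sum_le R V G rad x y S
  (fun z => grad G rad f z - 1 + (f z - f x)) (fun w => f w - f y) M M 1
  SP ltNS ltac:(lra).
rewrite big_split /= -/K => H.
have {H}/H : forall z, dist_le G x z 1 -> grad G rad f z - 1 + (f z - f x) <=
    M * (z \in rneighbors V G rad x S)%:R + 1.
  move=> z xz; have := fB z xz; have := gB z xz; rewrite fx.
  by case: (z \in _) => /=; lra.
move=> H; have {H}/H : forall w, dist_le G y w 1 ->
    M * (w \in S)%:R - 1 <= f w - f y.
  by move=> w _; rewrite fy /f /spike; case: (w == y) => /=; lra.
by rewrite -natr1; lra.
Qed.

Lemma curv_q_eqNy (R : realType) (V : choiceType) (G : lfgraph V) (rad : nat)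
    (x y : V) :
  (1 <= rad)%N -> dist_le G x y rad -> ~ has_transport_map G rad y x ->
  curv_q R G rad x y = -oo%E.
Proof.
move=> rad1 xy noT.
have [S [S0 SP ltNS]] := no_transport_hall_violator V G rad x y noT.
set n := #|` rneighbors V G rad x S|%fset in ltNS.
set K : R := (#|` fset_set (gball G 1 x)| + #|` fset_set (gball G 1 y)|)%:R.
(* The quadratic terms contribute [n M^2] at [x] and at least
   [(n + 1) M^2 / (a + 1)] at [y], so [a] must satisfy [n (a + 1) < n + 1]. *)
pose a : R := (n.+1)%:R^-1.
have n1 : 0 < (n.+1)%:R :> R by rewrite ltr0n.
have a0 : 0 < a by rewrite invr_gt0.
(* On [B_1(x)], [g] is at most [a + 1], so the quotient there is at most [2 + a^-1]; the summand
   [a + 1] is what gets subtracted at [y]. *)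
pose c := 2 + a^-1 + (a + 1).
apply: eq_ninfty => t; rewrite /curv_q lee_pdivrMl//.
(* For this [a] the quadratic terms combine to [- M ^+ 2 / n.+2], and [M >= 1] bounds [M ^+ 2] below
   by [M]. The 2 before [t] undoes the factor one half. *)
pose M : R := Num.max 1 ((n.+2)%:R * (c * K - 2 * t)).
have M1 : 1 <= M by rewrite /M le_max lexx.
have Mt : (n.+2)%:R * (c * K - 2 * t) <= M by rewrite /M le_max lexx orbT.
have [gx gy gradx gB gradB] := spike_spec R V G rad x y S a M rad1 xy M1 SP S0.
set g := spike _ _ _ _ _ _ in gx gy gradx gB gradB.
have g0 z : 0 < g z.
  by rewrite /g /spike; case: (z == y); case: (z \in S) => /=; lra.
have gxy : g y - g x = 1 by rewrite gx gy; lra.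
apply: ge_ereal_inf; eexists.
  by exists g => //=; split=> //; rewrite gxy normr1.
rewrite -EFinM lee_fin !lap_ballE gradx gxy sgr1 expr1n mul1r !mulr_suml gx gy.
have := hall_violator_sum_le R V G rad x y S
  (fun z => grad G rad g z ^+ 2 - 1 + (g z ^+ 2 - a ^+ 2) / a)
  (fun w => (g w ^+ 2 - (a + 1) ^+ 2) / (a + 1)) (M ^+ 2) (M ^+ 2 / (a + 1)) c
  SP ltNS.
have -> : 0 <= M ^+ 2 / (a + 1) by rewrite divr_ge0 ?sqr_ge0//; lra.
rewrite big_split /= -/K -/n => /(_ isT) H.
have {H}/H : forall z, dist_le G x z 1 ->
    grad G rad g z ^+ 2 - 1 + (g z ^+ 2 - a ^+ 2) / a <=
    M ^+ 2 * (z \in rneighbors V G rad x S)%:R + c.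
  move=> z xz; have /andP[g1 g2] := gB z xz.
  have : (g z ^+ 2 - a ^+ 2) / a <= 2 + a^-1.
    rewrite ler_pdivrMr// mulrDl mulVf ?gt_eqF//; nra.
  have := gradB z xz; rewrite /c.
  case: (z \in _) => /= /andP[d0 d1].
    have : grad G rad g z ^+ 2 <= M ^+ 2 by rewrite ler_pXn2r ?nnegrE//; lra.
    by lra.
  have : grad G rad g z ^+ 2 <= 1 ^+ 2 by rewrite ler_pXn2r ?nnegrE//; lra.
  by lra.
move=> H; have {H}/H : forall w, dist_le G y w 1 ->
    M ^+ 2 / (a + 1) * (w \in S)%:R - c <= (g w ^+ 2 - (a + 1) ^+ 2) / (a + 1).
  move=> w _.
  have gw : M * (w \in S)%:R <= g w by rewrite /g /spike; case: (w == y) => /=; lra.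
  have -> : (g w ^+ 2 - (a + 1) ^+ 2) / (a + 1) = g w ^+ 2 / (a + 1) - (a + 1).
    by field; rewrite gt_eqF//; lra.
  have ai : 0 < a^-1 by rewrite invr_gt0.
  have ca : a + 1 <= c by rewrite /c; lra.
  have gw2 : M ^+ 2 * (w \in S)%:R <= g w ^+ 2.
    case: (w \in S) gw => /= gw; last by rewrite mulr0 sqr_ge0.
    by rewrite mulr1 ler_pXn2r ?nnegrE//; lra.
  apply: lerB => //; rewrite mulrAC; apply: ler_wpM2r => //.
  by rewrite invr_ge0; lra.
have -> : M ^+ 2 * n%:R - M ^+ 2 / (a + 1) * (n.+1)%:R = - (M ^+ 2 / (n.+2)%:R).
  rewrite /a -[n.+2]addn1 -[n.+1]addn1 !natrD; have : 0 <= n%:R :> R by [].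
  by move=> ?; field; rewrite !gt_eqF //; lra.
have n2 : 0 < (n.+2)%:R :> R by rewrite ltr0n.
have MM : c * K - 2 * t <= M ^+ 2 / (n.+2)%:R.
  by rewrite ler_pdivlMr// mulrC; apply: le_trans Mt _; nra.
set q := _ / _ in MM *.
by move=> ?; lra.
Qed.

(** The gradient is now bounded globally by [r], so a tall spike is excluded; a staircase with steps
    of height [r] replaces it, and [r] itself grows. *)
Lemma curv_e_eqNy (R : realType) (V : choiceType) (G : lfgraph V) (rad : nat)
    (x y : V) :
  (1 <= rad)%N -> dist_le G x y rad -> ~ has_transport_map G rad y x ->
  curv_e R G rad x y = -oo%E.
Proof.
move=> rad1 xy noT.
have [S [/fset0Pn[w0 w0S] SP ltNS]] := no_transport_hall_violator V G rad x y noT.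
set n := #|` rneighbors V G rad x S|%fset in ltNS.
set K : R := (#|` fset_set (gball G 1 x)| + #|` fset_set (gball G 1 y)|)%:R.
have K0 : 0 <= K by rewrite ler0n.
apply: eq_ninfty => t.
pose r : R := Num.max 1 (4 * (K - t)).
have r1 : 1 <= r by rewrite /r le_max lexx.
have rt : 4 * (K - t) <= r by rewrite /r le_max lexx orbT.
have r0 : 0 < r by lra.
pose near z := has (fun w => dist_le G w z rad) S.
(* The middle level separates [S] from level 0 by more than [rad], so no jump within distance [rad]
   exceeds 1. *)
pose h z : R := if z \in S then 2 else if near z then 1 else 0.
have nS z : dist_le G x z rad -> z \notin S.
  by move=> xz; apply/negP => /SP[_]; rewrite xz.
have nearx : near x = false.
  by apply/negP => /hasP[w /SP[_ /negP xw] /dist_le_sym].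
have neary : near y.
  apply/hasP; exists w0 => //; have [yw _] := SP _ w0S.
  exact/dist_le_sym/(dist_le_mono _ _ _ _ _ _ rad1).
have hx : h x = 0 by rewrite /h (negbTE (nS x (dist_le_refl _ _ _ _))) nearx.
have hy : h y = 1 by rewrite /h (negbTE (nS y xy)) neary.
have hD z w : dist_le G z w rad -> `|h w - h z| <= 1.
  move=> zw; have nearw : z \in S -> near w by move=> zS; apply/hasP; exists z.
  have nearz : w \in S -> near z.
    by move=> wS; apply/hasP; exists w => //; exact: dist_le_sym.
  rewrite /h ler_norml; case: (z \in S) nearw => [->//|_].
    by case: (w \in S) => /=; lra.
  case: (w \in S) nearz => [->//|_]; first lra.
  by case: (near z); case: (near w); lra.
pose g z := r * h z.
have gD z w : g w - g z = r * (h w - h z) by rewrite /g mulrBr.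
have gxy : g y - g x = r by rewrite gD hx hy; lra.
have gr : grad_norm G rad g = r%:E.
  apply/eqP; rewrite eq_le; apply/andP; split.
    apply: ge_ereal_sup => _ [z _ <-]; rewrite lee_fin; apply: grad_le => w zw.
    by rewrite gD normrM gtr0_norm// ler_piMr ?hD// ltW.
  apply: le_trans (_ : ((grad G rad g x)%:E <= _)%E).
    rewrite lee_fin; apply: le_trans (grad_ge _ _ _ _ _ _ _ xy).
    by rewrite gxy ler_norm.
  by apply: ereal_sup_ubound; exists x.
apply: ge_ereal_inf; eexists; first by exists r.
rewrite lee_pdivrMl//; apply: ge_ereal_inf; eexists; first by exists g.
rewrite -EFinM lee_fin !lap_ballE.
have expE v w : (expR (g w) - expR (g v)) / expR (g v) = expR (g w - g v) - 1.
  by rewrite mulrBl divff ?gt_eqF ?expR_gt0// expRD expRN.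
rewrite !mulr_suml.
under eq_bigr do rewrite expE.
under [X in _ - X]eq_bigr do rewrite expE.
have E0 := expR_gt0 r.
(* Points of [N] are one step above [x], points of [S] one step above [y]: both contribute [expR r],
   for a total of at most [K - expR r]. *)
apply: le_trans (hall_violator_sum_le R V G rad x y S _ _ (expR r) (expR r) 1
  SP ltNS (ltW E0) _ _) _.
- move=> z xz; rewrite gD hx subr0.
  have zS := nS z (dist_le_mono _ _ _ _ _ _ rad1 xz).
  rewrite !inE in_fball xz /= /h (negbTE zS) -/(near z).
  by case: (near z); rewrite /= ?mulr1 ?mulr0 ?expR0; lra.
- move=> w yw; rewrite gD hy lerD2r /h; have := expR_gt0 (r * (h w - 1)).
  rewrite /h; case: (w \in S) => /=; last by rewrite mulr0 => /ltW.
  by rewrite mulr1 (_ : 2 - 1 = 1 :> R) ?mulr1//; lra.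
rewrite -/n -/K -natr1.
(* The factor [r^-1] must be beaten, so a quadratic lower bound is taken by squaring the linear one
   at [r / 2]. *)
have : r * r / 4 <= expR r.
  have -> : expR r = expR (r / 2) * expR (r / 2).
    by rewrite -expRD; congr expR; lra.
  have := expR_ge1Dx (r / 2); nra.
by nra.
Qed.

(** * Assembly of the bounds and the cycle of equivalences *)

Theorem theorem1p12 (R : realType) (V : choiceType) (G : lfgraph V)
    (rad : nat) (x y : V) (rad_ge1 : (1 <= rad)%N)
    (dxy : dist_le G x y rad) :
  [/\ (~ has_transport_map G rad y x ->
        [/\ curv R G rad x y = -oo%E,
            curv_q R G rad x y = -oo%E &
            curv_e R G rad x y = -oo%E]),
      (has_transport_map G rad y x ->
        [/\ (- defect G R rad y x <= curv R G rad x y)%E,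
            (- defect G R rad y x <= curv_e R G rad x y)%E &
            (- ((3 / 2 : R)%:E * defect G R rad y x) <= curv_q R G rad x y)%E]) &
      [<-> has_transport_map G rad y x /\ has_transport_map G rad x y;
           defect G R rad y x = 0%E;
           (0 <= curv R G rad x y)%E /\ (0 <= curv R G rad y x)%E;
           (0 <= curv_q R G rad x y)%E /\ (0 <= curv_q R G rad y x)%E;
           (0 <= curv_e R G rad x y)%E /\ (0 <= curv_e R G rad y x)%E]].
Proof.
split.
- move=> noT; split; [exact: curv_eqNy|exact: curv_q_eqNy|exact: curv_e_eqNy].
- move=> /(defect_attained _ _ R)[A [phi [T ->]]]; rewrite -EFinM -!EFinN.
  by split; [exact: curv_ge|exact: curv_e_ge|exact: curv_q_ge].
(* The merged map has defect zero, so the three lower bounds become nonnegativity. *)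
have curvs_ge0 u v : has_transport_map G rad v u -> has_transport_map G rad u v ->
    [/\ (0 <= curv R G rad u v)%E, (0 <= curv_q R G rad u v)%E &
        (0 <= curv_e R G rad u v)%E].
  move=> Tvu Tuv; have [A [phi [T defT]]] := transport_maps_merge _ _ _ _ _ Tvu Tuv.
  have := curv_ge R _ _ _ _ _ _ _ rad_ge1 T; have := curv_q_ge R _ _ _ _ _ _ _ rad_ge1 T.
  by have := curv_e_ge R _ _ _ _ _ _ _ rad_ge1 T; rewrite defT mulr0 oppr0.
(* Nonnegativity in both orientations excludes the value [-oo] forced by a missing map, so each
   curvature condition leads back to (a). *)
have transport_of_ge0 (K : V -> V -> \bar R) :
    (forall u v, dist_le G u v rad -> ~ has_transport_map G rad v u ->
      K u v = -oo%E) ->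
    (0 <= K x y)%E /\ (0 <= K y x)%E ->
    has_transport_map G rad y x /\ has_transport_map G rad x y.
  move=> KNy [Kxy Kyx]; split; apply: contrapT => noT.
    by move: Kxy; rewrite KNy.
  by move: Kyx; rewrite KNy//; exact: dist_le_sym.
have E1 := defect_eq0 V G R rad x y.
have curvT := transport_of_ge0 _ (fun u v => curv_eqNy R V G rad u v rad_ge1).
have curvqT := transport_of_ge0 _ (fun u v => curv_q_eqNy R V G rad u v rad_ge1).
have curveT := transport_of_ge0 _ (fun u v => curv_e_eqNy R V G rad u v rad_ge1).
(* The arrows between curvature conditions all pass through (a). *)
tfae.
- by move=> /E1.
- by move=> /E1[Tyx Txy]; have [] := curvs_ge0 x y Tyx Txy; have [] := curvs_ge0 y x Txy Tyx.
- by move=> /curvT[Tyx Txy]; have [] := curvs_ge0 x y Tyx Txy; have [] := curvs_ge0 y x Txy Tyx.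
- by move=> /curvqT[Tyx Txy]; have [] := curvs_ge0 x y Tyx Txy; have [] := curvs_ge0 y x Txy Tyx.
- exact: curveT.
Qed.
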